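(* Let $k$ be a field and let $\mathcal{A}$ be an abelian, $k$-linear category with finite homological dimension. Let $K=K_0(\mathcal{A})$ be its Grothendieck group, and suppose $\dim_k\mathrm{Ext}^i(M,N)$ is finite for all objects $M,N\in\mathcal{A}$ and all $i$. Let $q$ be a non-zero element of $k$. Then the category $\mathrm{Vect}^K$ of $K$-graded $k$-vector spaces and grade-preserving linear operators is a braided monoidal category, with the braiding $B_{V,W}\colon V\otimes W\to W\otimes V$ given by $$v\otimes w\mapsto q^{-\langle n,m\rangle}\,w\otimes v\qquad\text{for } v\in V_n,\ w\in W_m,\ n,m\in K.$$
   Context: The Grothendieck group $K_0(\mathcal{A})$ is the abelian group generated by isomorphism classes of objects of $\mathcal{A}$ modulo the relations $[C]=[A]+[B]$ for every short exact sequence $0\to A\to C\to B\to 0$. Finite homological dimension $d$ means $\mathrm{Ext}^i(M,N)=0$ for all $i>d$ and all objects $M,N$; here $\mathrm{Ext}^0=\mathrm{Hom}$. The bilinear form $\langle\cdot,\cdot\rangle$ on $K$ is determined by $$\langle \underline{m},\underline{n}\rangle=\sum_{i=0}^d(-1)^i\dim_k\mathrm{Ext}^i(M,N),$$ where $\underline{m},\underline{n}\in K$ are the classes of $M,N$; it takes integer values. The monoidal structure on $\mathrm{Vect}^K$ is the usual tensor product of vector spaces (usual associator and unitors, unit object $k$ in degree $0$), graded by $(V\otimes W)_d=\bigoplus_{n\in K}V_n\otimes W_{d-n}$. *)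

(* Defs.v *)
From HB Require Import structures.
From mathcomp Require Import all_boot all_order all_algebra generic_quotient.
From mathcomp Require Import boolp classical_sets.
From mathcomp Require Import freeg.

Set Implicit Arguments.
Unset Strict Implicit.
Unset Printing Implicit Defensive.

Import GRing.Theory.

Local Open Scope ring_scope.
Local Open Scope quotient_scope.

Section Quotient.
Context {R : nzRingType} {V : lmodType R} (S : V -> Prop).

Definition spanned (x : V) : Prop :=
  exists2 s : seq (R * V), forall cr, cr \in s -> S cr.2
                         & x = \sum_(cr <- s) cr.1 *: cr.2.

Lemma spanned0 : spanned 0.
Proof. by exists [::]; rewrite ?big_nil. Qed.

Lemma spannedD x y : spanned x -> spanned y -> spanned (x + y).
Proof.
move=> [s Ss ->] [t St ->]; exists (s ++ t); last by rewrite big_cat.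
by move=> cr; rewrite mem_cat => /orP[/Ss|/St].
Qed.

Lemma spannedZ a x : spanned x -> spanned (a *: x).
Proof.
move=> [s Ss ->]; exists [seq (a * cr.1, cr.2) | cr <- s].
  by move=> _ /mapP[cr /Ss + ->].
by rewrite big_map scaler_sumr; apply: eq_bigr => cr _; rewrite scalerA.
Qed.

Definition span_eqv : rel V := fun x y => `[< spanned (x - y) >].

Fact span_eqv_refl : reflexive span_eqv.
Proof. by move=> x; apply/asboolP; rewrite subrr; exact: spanned0. Qed.

Fact span_eqv_sym : symmetric span_eqv.
Proof.
suff H x y : span_eqv x y -> span_eqv y x by move=> x y; apply/idP/idP => /H.
by move=> /asboolP/(spannedZ (-1)); rewrite scaleN1r opprB => /asboolP.
Qed.

Fact span_eqv_trans : transitive span_eqv.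
Proof.
move=> y x z /asboolP xy /asboolP yz; apply/asboolP.
by have := spannedD xy yz; rewrite addrA subrK.
Qed.

Canonical span_equiv := EquivRel span_eqv span_eqv_refl span_eqv_sym
  span_eqv_trans.

Definition lquot := {eq_quot span_equiv}.

HB.instance Definition _ := Choice.on lquot.
HB.instance Definition _ := EqQuotient.on lquot.

Lemma lquot_eqP (x y : V) :
  (\pi_lquot x = \pi_lquot y) <-> spanned (x - y).
Proof. by split=> [/eqquotP/asboolP|/asboolP ?]; last exact/eqquotP. Qed.

Fact lquot_ind (P : lquot -> Prop) :
  (forall x : V, P (\pi_lquot x)) -> forall x, P x.
Proof. by move=> Ppi x; rewrite -[x]reprK. Qed.

Definition lquot_zero : lquot := \pi_lquot (0 : V).
Definition lquot_add (x y : lquot) : lquot := \pi_lquot (repr x + repr y : V).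
Definition lquot_opp (x : lquot) : lquot := \pi_lquot (- repr x : V).
Definition lquot_scale (a : R) (x : lquot) : lquot :=
  \pi_lquot (a *: repr x : V).

Fact lquot_reprP (x : V) : spanned (repr (\pi_lquot x) - x).
Proof. by apply/lquot_eqP; rewrite reprK. Qed.

Fact lquot_addE x y : lquot_add (\pi_lquot x) (\pi_lquot y) = \pi_lquot (x + y).
Proof.
apply/lquot_eqP; rewrite opprD addrACA.
by apply: spannedD; exact: lquot_reprP.
Qed.

Fact lquot_scaleE a x : lquot_scale a (\pi_lquot x) = \pi_lquot (a *: x).
Proof. by apply/lquot_eqP; rewrite -scalerBr; apply/spannedZ/lquot_reprP. Qed.

Fact lquot_oppE x : lquot_opp (\pi_lquot x) = \pi_lquot (- x).
Proof. by rewrite -scaleN1r -lquot_scaleE /lquot_opp -scaleN1r. Qed.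

Fact lquot_addA : associative lquot_add.
Proof.
by elim/lquot_ind => x; elim/lquot_ind => y; elim/lquot_ind => z; rewrite !lquot_addE addrA.
Qed.

Fact lquot_addC : commutative lquot_add.
Proof. by elim/lquot_ind => x; elim/lquot_ind => y; rewrite !lquot_addE addrC. Qed.

Fact lquot_add0 : left_id lquot_zero lquot_add.
Proof. by elim/lquot_ind => x; rewrite lquot_addE add0r. Qed.

Fact lquot_addN : left_inverse lquot_zero lquot_opp lquot_add.
Proof. by elim/lquot_ind => x; rewrite lquot_oppE lquot_addE addNr. Qed.

HB.instance Definition _ := GRing.isZmodule.Build lquot
  lquot_addA lquot_addC lquot_add0 lquot_addN.

Fact lquot_addrE (x y : lquot) : x + y = lquot_add x y.
Proof. by []. Qed.

Fact lquot_scaleA a b x : lquot_scale a (lquot_scale b x) = lquot_scale (a * b) x.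
Proof. by elim/lquot_ind: x => x; rewrite !lquot_scaleE scalerA. Qed.

Fact lquot_scale1 : left_id 1 lquot_scale.
Proof. by elim/lquot_ind => x; rewrite lquot_scaleE scale1r. Qed.

Fact lquot_scaleDr : right_distributive lquot_scale +%R.
Proof.
move=> a; elim/lquot_ind => x; elim/lquot_ind => y.
by rewrite !lquot_addrE !(lquot_scaleE, lquot_addE) scalerDr.
Qed.

Fact lquot_scaleDl x : {morph lquot_scale^~ x : a b / a + b}.
Proof.
move=> a b; elim/lquot_ind: x => x.
by rewrite !lquot_addrE !lquot_scaleE lquot_addE scalerDl.
Qed.

HB.instance Definition _ := GRing.Zmodule_isLmodule.Build R lquot
  lquot_scaleA lquot_scale1 lquot_scaleDr lquot_scaleDl.

Fact lquot_pi_linear : linear (\pi_lquot : V -> lquot).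
Proof.
by move=> a x y; rewrite -lquot_addE -lquot_scaleE.
Qed.

End Quotient.

Definition presented (R : nzRingType) (G : choiceType)
  (r : {freeg G / R} -> Prop) : lmodType R := lquot r.

Definition generator (R : nzRingType) (G : choiceType)
  (r : {freeg G / R} -> Prop) (g : G) : presented r := \pi_(lquot r) << g >>.

Section LinearAlgebra.
Context {k : fieldType}.

Definition has_dim (V : lmodType k) (r : nat) : Prop :=
  exists b : 'I_r -> V,
    bijective (fun c : 'rV[k]_r => \sum_(i < r) c 0 i *: b i).

Definition finite_dim (V : lmodType k) : Prop := exists r, has_dim V r.

(* The dimension is 0 by convention when V is not finite-dimensional. *)
Definition vdim (V : lmodType k) : nat := xget 0%N [set r | has_dim V r].

Section Tensor.
Variables U V : lmodType k.

Variant tensor_rel : {freeg (U * V)%type / k} -> Prop :=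
| TensorDl u u' v : tensor_rel (<< (u + u', v) >> - << (u, v) >> - << (u', v) >>)
| TensorDr u v v' : tensor_rel (<< (u, v + v') >> - << (u, v) >> - << (u, v') >>)
| TensorZl a u v : tensor_rel (<< (a *: u, v) >> - a *: << (u, v) >>)
| TensorZr a u v : tensor_rel (<< (u, a *: v) >> - a *: << (u, v) >>).

Definition tensor : lmodType k := presented tensor_rel.

Definition tens (u : U) (v : V) : tensor := generator tensor_rel (u, v).

End Tensor.

Section DirectSum.
Variables (I : choiceType) (U : I -> lmodType k).

Variant dsum_rel : {freeg {i : I & U i} / k} -> Prop :=
| DsumD i (u u' : U i) :
    dsum_rel (<< Tagged U (u + u') >> - << Tagged U u >> - << Tagged U u' >>)
| DsumZ a i (u : U i) :
    dsum_rel (<< Tagged U (a *: u) >> - a *: << Tagged U u >>).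

Definition dsum : lmodType k := presented dsum_rel.

Definition dsum_in (i : I) (u : U i) : dsum := generator dsum_rel (Tagged U u).

End DirectSum.

Lemma linear_ext (U V : lmodType k) (f g : {linear U -> V}) : f =1 g -> f = g.
Proof.
case: f g => f [[fD] [fZ]] [g [[gD] [gZ]]] /= /funext fg.
case: _ / fg in gD gZ *.
by rewrite (Prop_irrelevance fD gD) (Prop_irrelevance fZ gZ).
Qed.

End LinearAlgebra.

Arguments dsum_in {k I U} i u.

Record category := Category {
  ob :> Type;
  mor : ob -> ob -> Type;
  idc : forall X, mor X X;
  mcomp : forall X Y Z, mor Y Z -> mor X Y -> mor X Z;
  mcomp1f : forall X Y (f : mor X Y), mcomp (idc Y) f = f;
  mcompf1 : forall X Y (f : mor X Y), mcomp f (idc X) = f;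
  mcompA : forall X Y Z T (h : mor Z T) (g : mor Y Z) (f : mor X Y),
    mcomp h (mcomp g f) = mcomp (mcomp h g) f }.

Arguments mor {c} : rename.
Arguments idc {c} X : rename.
Arguments mcomp {c X Y Z} : rename.

Notation "g \oc f" := (mcomp g f) (at level 40, left associativity).

Section CategoryNotions.
Context {C : category}.
Implicit Types X Y Z : C.

Definition is_iso X Y (f : mor X Y) : Prop :=
  exists g : mor Y X, g \oc f = idc X /\ f \oc g = idc Y.

Definition isomorphic X Y : Prop := exists f : mor X Y, is_iso f.

End CategoryNotions.

Record linear_category (k : fieldType) := LinearCategory {
  lob :> Type;
  lhom : lob -> lob -> lmodType k;
  lid : forall X, lhom X X;
  lcomp : forall X Y Z, lhom Y Z -> lhom X Y -> lhom X Z;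
  lcomp1f : forall X Y (f : lhom X Y), lcomp (lid Y) f = f;
  lcompf1 : forall X Y (f : lhom X Y), lcomp f (lid X) = f;
  lcompA : forall X Y Z T (h : lhom Z T) (g : lhom Y Z) (f : lhom X Y),
    lcomp h (lcomp g f) = lcomp (lcomp h g) f;
  lcomp_linearl : forall X Y Z (f : lhom X Y),
    linear (fun g : lhom Y Z => lcomp g f);
  lcomp_linearr : forall X Y Z (g : lhom Y Z),
    linear (fun f : lhom X Y => lcomp g f) }.

Arguments lhom {k l} : rename.
Arguments lid {k l} X : rename.
Arguments lcomp {k l X Y Z} : rename.

Notation "g \ol f" := (lcomp g f) (at level 40, left associativity).

Coercion category_of_linear (k : fieldType) (A : linear_category k) : category :=
  @Category A lhom lid (@lcomp k A) (@lcomp1f k A) (@lcompf1 k A) (@lcompA k A).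

Section LinearCategoryNotions.
Context {k : fieldType} {A : linear_category k}.
Implicit Types X Y Z : A.

Definition is_mono X Y (f : lhom X Y) : Prop :=
  forall Z (g h : lhom Z X), f \ol g = f \ol h -> g = h.

Definition is_epi X Y (f : lhom X Y) : Prop :=
  forall Z (g h : lhom Y Z), g \ol f = h \ol f -> g = h.

Definition is_zero_object Z : Prop :=
  (forall X (f g : lhom X Z), f = g) /\ (forall X (f g : lhom Z X), f = g).

Definition is_kernel K X Y (i : lhom K X) (f : lhom X Y) : Prop :=
  f \ol i = 0 /\
  forall Z (g : lhom Z X), f \ol g = 0 ->
    exists! h : lhom Z K, i \ol h = g.

Definition is_cokernel X Y Q (p : lhom Y Q) (f : lhom X Y) : Prop :=
  p \ol f = 0 /\
  forall Z (g : lhom Y Z), g \ol f = 0 ->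
    exists! h : lhom Q Z, h \ol p = g.

Definition is_ses X Y Z (i : lhom X Y) (p : lhom Y Z) : Prop :=
  is_kernel i p /\ is_cokernel p i.

End LinearCategoryNotions.

Record abelian_category (k : fieldType) := AbelianCategory {
  abcat :> linear_category k;
  exists_zero : exists Z : abcat, is_zero_object Z;
  biprod : abcat -> abcat -> abcat;
  in1 : forall X Y, lhom X (biprod X Y);
  in2 : forall X Y, lhom Y (biprod X Y);
  pr1 : forall X Y, lhom (biprod X Y) X;
  pr2 : forall X Y, lhom (biprod X Y) Y;
  pr1_in1 : forall X Y, pr1 X Y \ol in1 X Y = lid X;
  pr2_in2 : forall X Y, pr2 X Y \ol in2 X Y = lid Y;
  pr1_in2 : forall X Y, pr1 X Y \ol in2 X Y = 0;
  pr2_in1 : forall X Y, pr2 X Y \ol in1 X Y = 0;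
  biprod_id : forall X Y,
    (in1 X Y \ol pr1 X Y) + (in2 X Y \ol pr2 X Y) = lid (biprod X Y);
  exists_kernel : forall (X Y : abcat) (f : lhom X Y),
    exists (K : abcat) (i : lhom K X), is_kernel i f;
  exists_cokernel : forall (X Y : abcat) (f : lhom X Y),
    exists (Q : abcat) (p : lhom Y Q), is_cokernel p f;
  mono_normal : forall (X Y : abcat) (f : lhom X Y), is_mono f ->
    exists (Z : abcat) (g : lhom Y Z), is_kernel f g;
  epi_normal : forall (X Y : abcat) (f : lhom X Y), is_epi f ->
    exists (Z : abcat) (g : lhom Z X), is_cokernel f g }.

Section Grothendieck.
Context {k : fieldType} (A : abelian_category k).

Variant K0_rel : {freeg {classic A} / int} -> Prop :=
| K0_iso (X Y : A) : @isomorphic A X Y ->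
    K0_rel (<< (X : {classic A}) >> - << (Y : {classic A}) >>)
| K0_ses (X Y Z : A) (i : lhom X Y) (p : lhom Y Z) : is_ses i p ->
    K0_rel (<< (Y : {classic A}) >>
            - (<< (X : {classic A}) >> + << (Z : {classic A}) >>)).

Definition K0 : zmodType := presented K0_rel.

Definition K0_class (X : A) : K0 := generator K0_rel (X : {classic A}).

End Grothendieck.

Section Ext.
Context {k : fieldType} {A : abelian_category k}.
Implicit Types M N X : A.

Record ses (M N : A) := Ses {
  mid : A;
  inj : lhom N mid;
  prj : lhom mid M;
  ses_exact : is_ses inj prj }.

(* An exact sequence 0 -> N -> E_n -> ... -> E_0 -> M -> 0 with n + 1 middle  *)
(* terms, given as the splice of 0 -> N -> E_n -> X -> 0 with an exact        *)
(* sequence 0 -> X -> E_(n-1) -> ... -> E_0 -> M -> 0.                        *)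
Fixpoint extension (n : nat) (M N : A) : Type :=
  if n is n'.+1 then {X : A & (ses X N * extension n' M X)%type} else ses M N.

Definition ses_morphism M N M' N' (S : ses M N) (S' : ses M' N')
    (f : lhom M M') (g : lhom N N') : Prop :=
  exists h : lhom (mid S) (mid S'),
    h \ol inj S = inj S' \ol g /\ prj S' \ol h = f \ol prj S.

(* There is a morphism of exact sequences from E to E' which is f on the      *)
(* right end and g on the left end.                                           *)
Fixpoint ext_morphism (n : nat) (M N M' N' : A) :
    extension n M N -> extension n M' N' -> lhom M M' -> lhom N N' -> Prop :=
  match n with
  | 0 => fun E E' f g => ses_morphism E E' f g
  | n'.+1 => fun E E' f g => exists h : lhom (tag E) (tag E'),
      ses_morphism (tagged E).1 (tagged E').1 h g /\
      ext_morphism (tagged E).2 (tagged E').2 f h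
  end.

Definition biprod_map X Y X' Y' (f : lhom X X') (g : lhom Y Y') :
    lhom (biprod X Y) (biprod X' Y') :=
  (in1 X' Y' \ol (f \ol pr1 X Y)) + (in2 X' Y' \ol (g \ol pr2 X Y)).

Definition diagonal X : lhom X (biprod X X) := in1 X X + in2 X X.

Definition codiagonal X : lhom (biprod X X) X := pr1 X X + pr2 X X.

Let lcomp0 X Y Z (g : lhom Y Z) : g \ol (0 : lhom X Y) = 0.
Proof.
have := @lcomp_linearr k A X Y Z g 1 0 0.
by rewrite scaler0 addr0 scale1r => /eqP; rewrite -subr_eq subrr eq_sym => /eqP.
Qed.

Let l0comp X Y Z (f : lhom X Y) : (0 : lhom Y Z) \ol f = 0.
Proof.
have := @lcomp_linearl k A X Y Z f 1 0 0.
by rewrite scaler0 addr0 scale1r => /eqP; rewrite -subr_eq subrr eq_sym => /eqP.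
Qed.

Let lcompD X Y Z (g : lhom Y Z) (f f' : lhom X Y) :
  g \ol (f + f') = g \ol f + g \ol f'.
Proof. by have := @lcomp_linearr k A X Y Z g 1 f f'; rewrite !scale1r. Qed.

Let lDcomp X Y Z (g g' : lhom Y Z) (f : lhom X Y) :
  (g + g') \ol f = g \ol f + g' \ol f.
Proof. by have := @lcomp_linearl k A X Y Z f 1 g g'; rewrite !scale1r. Qed.

Let pr1_map X Y X' Y' (f : lhom X X') (g : lhom Y Y') :
  pr1 X' Y' \ol biprod_map f g = f \ol pr1 X Y.
Proof.
by rewrite lcompD !lcompA pr1_in1 pr1_in2 lcomp1f !l0comp addr0.
Qed.

Let pr2_map X Y X' Y' (f : lhom X X') (g : lhom Y Y') :
  pr2 X' Y' \ol biprod_map f g = g \ol pr2 X Y.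
Proof.
by rewrite lcompD !lcompA pr2_in1 pr2_in2 lcomp1f !l0comp add0r.
Qed.

Let map_in1 X Y X' Y' (f : lhom X X') (g : lhom Y Y') :
  biprod_map f g \ol in1 X Y = in1 X' Y' \ol f.
Proof.
by rewrite lDcomp -!lcompA pr1_in1 pr2_in1 lcompf1 !lcomp0 addr0.
Qed.

Let map_in2 X Y X' Y' (f : lhom X X') (g : lhom Y Y') :
  biprod_map f g \ol in2 X Y = in2 X' Y' \ol g.
Proof.
by rewrite lDcomp -!lcompA pr1_in2 pr2_in2 lcompf1 !lcomp0 add0r.
Qed.

Let pr_ext X Y Z (f g : lhom Z (biprod X Y)) :
  pr1 X Y \ol f = pr1 X Y \ol g -> pr2 X Y \ol f = pr2 X Y \ol g -> f = g.
Proof.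
move=> e1 e2.
by rewrite -(lcomp1f f) -(lcomp1f g) -biprod_id !lDcomp -!lcompA e1 e2.
Qed.

Let in_ext X Y Z (f g : lhom (biprod X Y) Z) :
  f \ol in1 X Y = g \ol in1 X Y -> f \ol in2 X Y = g \ol in2 X Y -> f = g.
Proof.
move=> e1 e2.
by rewrite -(lcompf1 f) -(lcompf1 g) -biprod_id !lcompD !lcompA e1 e2.
Qed.

Let pr1_pair X Y Z (f : lhom Z X) (g : lhom Z Y) :
  pr1 X Y \ol (in1 X Y \ol f + in2 X Y \ol g) = f.
Proof. by rewrite lcompD !lcompA pr1_in1 pr1_in2 l0comp addr0 lcomp1f. Qed.

Let pr2_pair X Y Z (f : lhom Z X) (g : lhom Z Y) :
  pr2 X Y \ol (in1 X Y \ol f + in2 X Y \ol g) = g.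
Proof. by rewrite lcompD !lcompA pr2_in1 pr2_in2 l0comp add0r lcomp1f. Qed.

Let copair_in1 X Y Z (f : lhom X Z) (g : lhom Y Z) :
  (f \ol pr1 X Y + g \ol pr2 X Y) \ol in1 X Y = f.
Proof. by rewrite lDcomp -!lcompA pr1_in1 pr2_in1 lcomp0 addr0 lcompf1. Qed.

Let copair_in2 X Y Z (f : lhom X Z) (g : lhom Y Z) :
  (f \ol pr1 X Y + g \ol pr2 X Y) \ol in2 X Y = g.
Proof. by rewrite lDcomp -!lcompA pr1_in2 pr2_in2 lcomp0 add0r lcompf1. Qed.

Lemma biprod_is_ses X Y Z X' Y' Z' (i : lhom X Y) (p : lhom Y Z)
    (i' : lhom X' Y') (p' : lhom Y' Z') :
  is_ses i p -> is_ses i' p' -> is_ses (biprod_map i i') (biprod_map p p').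
Proof.
move=> [[pi0 keri] [_ cokp]] [[pi0' keri'] [_ cokp']].
have pi0s : biprod_map p p' \ol biprod_map i i' = 0.
  apply: pr_ext; rewrite lcompA ?pr1_map ?pr2_map -lcompA ?pr1_map ?pr2_map.
    by rewrite lcompA pi0 l0comp lcomp0.
  by rewrite lcompA pi0' l0comp lcomp0.
split; split=> // T g g0.
- have [|h1 [h1g h1u]] := keri _ (pr1 _ _ \ol g).
    by rewrite lcompA -(pr1_map p p') -lcompA g0 lcomp0.
  have [|h2 [h2g h2u]] := keri' _ (pr2 _ _ \ol g).
    by rewrite lcompA -(pr2_map p p') -lcompA g0 lcomp0.
  exists (in1 _ _ \ol h1 + in2 _ _ \ol h2); split.
    apply: pr_ext; rewrite lcompA ?pr1_map ?pr2_map -lcompA.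
      by rewrite pr1_pair.
    by rewrite pr2_pair.
  move=> h hg; apply: pr_ext; rewrite ?pr1_pair ?pr2_pair.
    by apply: h1u; rewrite lcompA -(pr1_map i i') -lcompA hg.
  by apply: h2u; rewrite lcompA -(pr2_map i i') -lcompA hg.
- have [|h1 [h1g h1u]] := cokp _ (g \ol in1 _ _).
    by rewrite -lcompA -(map_in1 i i') lcompA g0 l0comp.
  have [|h2 [h2g h2u]] := cokp' _ (g \ol in2 _ _).
    by rewrite -lcompA -(map_in2 i i') lcompA g0 l0comp.
  exists (h1 \ol pr1 _ _ + h2 \ol pr2 _ _); split.
    apply: in_ext; rewrite -lcompA ?map_in1 ?map_in2 lcompA.
      by rewrite copair_in1.
    by rewrite copair_in2.
  move=> h hg; apply: in_ext; rewrite ?copair_in1 ?copair_in2.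
    by apply: h1u; rewrite -lcompA -(map_in1 p p') lcompA hg.
  by apply: h2u; rewrite -lcompA -(map_in2 p p') lcompA hg.
Qed.

Definition ses_sum M N M' N' (S : ses M N) (S' : ses M' N') :
    ses (biprod M M') (biprod N N') :=
  Ses (biprod_is_ses (ses_exact S) (ses_exact S')).

Fixpoint ext_sum (n : nat) (M N M' N' : A) :
    extension n M N -> extension n M' N' ->
    extension n (biprod M M') (biprod N N') :=
  match n with
  | 0 => fun E E' => ses_sum E E'
  | n'.+1 => fun E E' =>
      existT _ (biprod (tag E) (tag E'))
        (ses_sum (tagged E).1 (tagged E').1, ext_sum (tagged E).2 (tagged E').2)
  end.

(* Yoneda's Ext^(n+1)(M, N) is the set of extensions modulo the equivalence   *)
(* generated by the morphisms with identity ends; it is a vector space for    *)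
(* the Baer sum codiagonal_* (diagonal^* (E (+) E')) and the scalar action    *)
(* (a id_N)_* E.  It is presented by its own elements and operations, i.e. by *)
(* the relators below.  The pushout g_* E is characterized by a morphism      *)
(* E -> g_* E with ends id_M and g, the pullback f^* E by a morphism          *)
(* f^* E -> E with ends f and id_N.                                           *)
Variant yoneda_rel (n : nat) (M N : A) :
    {freeg {classic extension n M N} / k} -> Prop :=
| YonedaEquiv (E E' : extension n M N) :
    ext_morphism E E' (lid M) (lid N) ->
    yoneda_rel (<< (E : {classic _}) >> - << (E' : {classic _}) >>)
| YonedaAdd (E E' E'' : extension n M N) (D : extension n M (biprod N N)) :
    ext_morphism D (ext_sum E E') (diagonal M) (lid (biprod N N)) ->
    ext_morphism D E'' (lid M) (codiagonal N) ->
    yoneda_rel (<< (E'' : {classic _}) >>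
                - (<< (E : {classic _}) >> + << (E' : {classic _}) >>))
| YonedaScale (a : k) (E E' : extension n M N) :
    ext_morphism E E' (lid M) (a *: lid N) ->
    yoneda_rel (<< (E' : {classic _}) >> - a *: << (E : {classic _}) >>).

Definition Ext (n : nat) (M N : A) : lmodType k :=
  if n is n'.+1 then presented (@yoneda_rel n' M N) else lhom M N.

End Ext.

Definition has_homological_dim (k : fieldType) (A : abelian_category k)
    (d : nat) : Prop :=
  forall (i : nat) (M N : A), (d < i)%N -> forall x : Ext i M N, x = 0.

Definition ext_finite (k : fieldType) (A : abelian_category k) : Prop :=
  forall (i : nat) (M N : A), finite_dim (Ext i M N).

Definition is_euler_form (k : fieldType) (A : abelian_category k) (d : nat)
    (form : K0 A -> K0 A -> int) : Prop :=
  [/\ forall x y z, form (x + y) z = form x z + form y z,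
      forall x y z, form x (y + z) = form x y + form x z
    & forall M N : A, form (K0_class M) (K0_class N) =
        \sum_(i < d.+1) (-1) ^+ i * (vdim (Ext i M N))%:Z].

Section Monoidal.
Variable C : category.

Record monoidal (ten : C -> C -> C) (one : C) := Monoidal {
  tenm : forall X X' Y Y', mor X X' -> mor Y Y' -> mor (ten X Y) (ten X' Y');
  tenm_id : forall X Y, tenm (idc X) (idc Y) = idc (ten X Y);
  tenm_comp : forall X X' X'' Y Y' Y'' (f : mor X X') (f' : mor X' X'')
      (g : mor Y Y') (g' : mor Y' Y''),
    tenm (f' \oc f) (g' \oc g) = tenm f' g' \oc tenm f g;
  assoc : forall X Y Z, mor (ten (ten X Y) Z) (ten X (ten Y Z));
  assocV : forall X Y Z, mor (ten X (ten Y Z)) (ten (ten X Y) Z);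
  assocK : forall X Y Z, assocV X Y Z \oc assoc X Y Z = idc _;
  assocVK : forall X Y Z, assoc X Y Z \oc assocV X Y Z = idc _;
  assoc_nat : forall X X' Y Y' Z Z' (f : mor X X') (g : mor Y Y') (h : mor Z Z'),
    assoc X' Y' Z' \oc tenm (tenm f g) h = tenm f (tenm g h) \oc assoc X Y Z;
  lunit : forall X, mor (ten one X) X;
  lunit_iso : forall X, is_iso (lunit X);
  lunit_nat : forall X X' (f : mor X X'),
    lunit X' \oc tenm (idc one) f = f \oc lunit X;
  runit : forall X, mor (ten X one) X;
  runit_iso : forall X, is_iso (runit X);
  runit_nat : forall X X' (f : mor X X'),
    runit X' \oc tenm f (idc one) = f \oc runit X;
  pentagon : forall X Y Z T,
    assoc X Y (ten Z T) \oc assoc (ten X Y) Z T =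
    tenm (idc X) (assoc Y Z T) \oc assoc X (ten Y Z) T
      \oc tenm (assoc X Y Z) (idc T);
  triangle : forall X Y,
    tenm (idc X) (lunit Y) \oc assoc X one Y = tenm (runit X) (idc Y) }.

Record braiding (ten : C -> C -> C) (one : C) (M : monoidal ten one) := Braiding {
  braid : forall X Y, mor (ten X Y) (ten Y X);
  braid_iso : forall X Y, is_iso (braid X Y);
  braid_nat : forall X X' Y Y' (f : mor X X') (g : mor Y Y'),
    braid X' Y' \oc tenm M f g = tenm M g f \oc braid X Y;
  hexagon1 : forall X Y Z,
    assoc M Y Z X \oc braid X (ten Y Z) \oc assoc M X Y Z =
    tenm M (idc Y) (braid X Z) \oc assoc M Y X Z \oc tenm M (braid X Y) (idc Z);
  hexagon2 : forall X Y Z,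
    assocV M Z X Y \oc braid (ten X Y) Z \oc assocV M X Y Z =
    tenm M (braid X Z) (idc Y) \oc assocV M X Z Y \oc tenm M (idc X) (braid Y Z) }.

End Monoidal.

Section GradedVect.
Variables (k : fieldType) (K : zmodType).

Definition graded := K -> lmodType k.

Definition graded_hom (V W : graded) := forall n, {linear V n -> W n}.

Definition graded_id (V : graded) : graded_hom V V := fun n => idfun.

Definition graded_comp (U V W : graded) (g : graded_hom V W)
  (f : graded_hom U V) : graded_hom U W := fun n => g n \o f n.

Fact graded_comp1f V W (f : graded_hom V W) : graded_comp (graded_id W) f = f.
Proof. by apply: functional_extensionality_dep => n; exact: linear_ext. Qed.

Fact graded_compf1 V W (f : graded_hom V W) : graded_comp f (graded_id V) = f.
Proof. by apply: functional_extensionality_dep => n; exact: linear_ext. Qed.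

Fact graded_compA U V W X (h : graded_hom W X) (g : graded_hom V W)
    (f : graded_hom U V) :
  graded_comp h (graded_comp g f) = graded_comp (graded_comp h g) f.
Proof. by apply: functional_extensionality_dep => n; exact: linear_ext. Qed.

Definition Vect : category :=
  Category graded_comp1f graded_compf1 graded_compA.

(* The sum over n in K of V_n (x) W_(d - n), indexed by the pairs (n, m) with *)
(* n + m = d.                                                                 *)
Definition gtensor (V W : Vect) : Vect := fun d =>
  dsum (fun nm : {nm : K * K | nm.1 + nm.2 == d} =>
    tensor (V (val nm).1) (W (val nm).2)).

Definition gtens (V W : Vect) (d n m : K) (nmd : n + m == d)
    (v : V n) (w : W m) : gtensor V W d :=
  dsum_in (U := fun nm : {nm : K * K | nm.1 + nm.2 == d} =>
             tensor (V (val nm).1) (W (val nm).2))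
    (exist _ (n, m) nmd) (tens v w).

(* Row vectors over k of length 1 in degree 0 and of length 0 elsewhere. *)
Definition gunit : Vect := fun n => 'rV[k]_(n == 0).

Definition gscalar (a : k) : gunit 0 := const_mx a.

End GradedVect.

Arguments gtensor : clear implicits.
Arguments gunit : clear implicits.

(* Main.v *)
(* Only biadditivity of the Euler form matters: c(n, m) = q^(-<n, m>) is then  *)
(* a bicharacter K x K -> k^*, and the two hexagons for v (x) w |-> c w (x) v  *)
(* amount to c(n, m + p) = c(n, m) c(n, p) and c(n + m, p) = c(n, p) c(m, p).  *)
(* The structure maps come from the universal property of V (x) W in each      *)
(* degree, and every coherence law is checked on pure tensors; degrees are     *)
(* related by propositional equalities n + m == e, so no transport is needed   *)
(* except in the unitors.                                                      *)

From HB Require Import structures.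
Require Import Defs.
From mathcomp Require Import all_boot all_order all_algebra generic_quotient.
From mathcomp Require Import boolp.
From mathcomp Require Import freeg.

Set Implicit Arguments.
Unset Strict Implicit.
Unset Printing Implicit Defensive.

Import GRing.Theory.
Local Open Scope ring_scope.
Local Open Scope quotient_scope.

(** Biadditivity of the Euler form makes [c n m = q ^ (- form n m)] a bicharacter of [K0 A] with
    non-zero values, and every such bicharacter braids graded vector spaces. Non-vanishing makes the
    weighted flip invertible, multiplicativity in each variable gives one of the two hexagons, and
    naturality holds because the weight depends on degrees alone.

    Tensor products and direct sums are given by generators and relations, so everything rests on
    one universal property: [presented_lift] produces linear maps and [presented_ext] compares them
    on generators. Together they yield [gtensor_lift] and [gtensor_ext]: a linear map out of one
    degree of a graded tensor product amounts to a family of bilinear maps and is determined on pure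
    tensors. [gtensor_ext_l] and [gtensor_ext_r] extend the latter to triple products. Each
    structure map thus comes with a formula on pure tensors (the [_sig] lemmas), and each coherence
    law follows by evaluating both sides. [graded_monoidal] and [graded_braiding] collect the
    results, the latter for an arbitrary bicharacter. *)

Lemma ex_linear (R : nzRingType) (U V : lmodType R) (f : U -> V) :
  linear f -> exists g : {linear U -> V}, g =1 f.
Proof.
move=> lf; pose L := GRing.isLinear.Build _ _ _ _ f lf.
by exists (HB.pack_for {linear U -> V} f L).
Qed.

(** * Universal property of modules given by generators and relations *)

Section Presented.
Context {R : nzRingType} {G : choiceType} (r : {freeg G / R} -> Prop).
Context {X : lmodType R}.

(** Additivity of [fglift] reduces compatibility with scalars to single terms of the formal sum,
    where it is associativity of the action. *)
Lemma freeg_lift_linear (f : G -> X) : linear (fglift f : {freeg G / R} -> X).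
Proof.
pose F : {additive {freeg G / R} -> X} :=
  HB.pack (fglift f) (GRing.isZmodMorphism.Build _ _ _ (lift_is_additive f)).
rewrite -[fglift f]/(F : _ -> _) => a D D'; rewrite raddfD; congr (_ + _).
have FE : F D = \sum_(z <- dom D) coeff z D *: f z.
  rewrite -[D in LHS]freeg_sumE raddf_sum.
  by apply: eq_bigr => z _; exact: liftU.
rewrite FE -{1}(freeg_sumE D) scaler_sumr raddf_sum scaler_sumr.
apply: eq_bigr => z _.
have -> : a *: << coeff z D *g z >> = << a * coeff z D *g z >> :> {freeg G / R}.
  by apply/eqP/freeg_eqP => y; rewrite coeffZ !coeffU mulrA.
by rewrite /= !liftU scalerA.
Qed.

Lemma presented_lift (f : G -> X) : (forall D, r D -> fglift f D = 0) ->
  exists h : {linear presented r -> X}, forall x, h (generator r x) = f x.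
Proof.
move=> rf; have [F FE] := ex_linear (freeg_lift_linear f).
have F0 D : spanned r D -> F D = 0.
  move=> [s rs ->]; rewrite linear_sum big1_seq // => cr /andP[_ /rs rcr].
  by rewrite linearZ /= FE rf // scaler0.
(* The choice of representative is harmless: two representatives differ by an element of the span of
   the relators, which [F] kills. *)
pose h (x : presented r) : X := F (repr x).
have hpi D : h (\pi_(lquot r) D) = F D.
  by apply/eqP; rewrite -subr_eq0 -linearB; apply/eqP/F0/lquot_reprP.
have linh : linear h.
  move=> a; elim/(@lquot_ind R _ r) => x; elim/(@lquot_ind R _ r) => y.
  by rewrite -lquot_pi_linear !hpi linearP.
have [g gE] := ex_linear linh.
by exists g => x; rewrite gE hpi FE liftU scale1r.
Qed.

Lemma presented_ext (f g : {linear presented r -> X}) :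
  (forall x, f (generator r x) = g (generator r x)) -> f =1 g.
Proof.
move=> fg; elim/(@lquot_ind R _ r) => D.
have [p pE] := ex_linear (lquot_pi_linear r).
rewrite -[D]freeg_sumE -pE !linear_sum; apply: eq_bigr => z _.
have -> : << coeff z D *g z >> = coeff z D *: << z >> :> {freeg G / R}.
  by apply/eqP/freeg_eqP => y; rewrite coeffZ !coeffU mul1r.
by rewrite !linearZ pE /= [f _]fg.
Qed.

End Presented.

Section Relators.
Context (R : nzRingType) (G : choiceType) (r : {freeg G / R} -> Prop).

Lemma generator_rel (D : {freeg G / R}) : r D -> \pi_(lquot r) D = 0.
Proof.
move=> rD; apply/lquot_eqP; rewrite subr0; exists [:: (1, D)].
  by move=> cr; rewrite inE => /eqP ->.
by rewrite big_seq1 scale1r.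
Qed.

Lemma generator_relD (x y z : G) : r (<< x >> - << y >> - << z >>) ->
  generator r x = generator r y + generator r z.
Proof.
(* The bundled copy [p] of the quotient map makes the rewriting rules for linear maps available. *)
have [p pE] := ex_linear (lquot_pi_linear r).
move/generator_rel; rewrite -pE -addrA -opprD linearB linearD /= !pE.
by move/eqP; rewrite subr_eq0 => /eqP.
Qed.

Lemma generator_relZ (a : R) (x y : G) : r (<< x >> - a *: << y >>) ->
  generator r x = a *: generator r y.
Proof.
have [p pE] := ex_linear (lquot_pi_linear r).
move/generator_rel; rewrite -pE linearB linearZ /= !pE.
by move/eqP; rewrite subr_eq0 => /eqP.
Qed.

End Relators.

(** * Tensor products and direct sums of vector spaces *)

Section Bilinear.
Context {k : fieldType}.

Definition is_bilinear (U V X : lmodType k) (f : U -> V -> X) : Prop :=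
  [/\ forall u u' v, f (u + u') v = f u v + f u' v,
      forall u v v', f u (v + v') = f u v + f u v',
      forall a u v, f (a *: u) v = a *: f u v
    & forall a u v, f u (a *: v) = a *: f u v].

Lemma tens_bilinear (U V : lmodType k) : is_bilinear (@tens k U V).
Proof.
split=> [u u' v|u v v'|a u v|a u v].
- exact: generator_relD (TensorDl u u' v).
- exact: generator_relD (TensorDr u v v').
- exact: generator_relZ (TensorZl a u v).
- exact: generator_relZ (TensorZr a u v).
Qed.

(** The four kinds of relators are sent to zero by the four clauses of bilinearity, respectively. *)
Lemma tensor_lift (U V X : lmodType k) (f : U -> V -> X) : is_bilinear f ->
  exists h : {linear tensor U V -> X}, forall u v, h (tens u v) = f u v.
Proof.
move=> [fDl fDr fZl fZr].
have [|h hE] := @presented_lift _ _ (@tensor_rel k U V) _ (fun uv => f uv.1 uv.2).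
  have [F FE] := ex_linear (@freeg_lift_linear k _ _ (fun uv => f uv.1 uv.2)).
  move=> D [u u' v|u v v'|a u v|a u v];
    rewrite -FE ?linearB ?linearZ /= !FE !liftU !scale1r /=.
  - by rewrite fDl -addrA -opprD subrr.
  - by rewrite fDr -addrA -opprD subrr.
  - by rewrite fZl scalerN subrr.
  - by rewrite fZr scalerN subrr.
by exists h => u v; rewrite hE.
Qed.

Lemma tensor_ext (U V X : lmodType k) (f g : {linear tensor U V -> X}) :
  (forall u v, f (tens u v) = g (tens u v)) -> f =1 g.
Proof. by move=> fg; apply: presented_ext => -[u v]; exact: fg. Qed.

Section DirectSum.
Context {I : choiceType} (U : I -> lmodType k) {X : lmodType k}.

Lemma dsum_in_linear (i : I) : linear (dsum_in i : U i -> dsum U).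
Proof.
move=> a u v; rewrite -[dsum_in i (a *: u + v)]/(generator _ _).
by rewrite (generator_relD (DsumD (a *: u) v)) (generator_relZ (DsumZ a u)).
Qed.

Lemma dsum_lift (f : forall i, {linear U i -> X}) :
  exists h : {linear dsum U -> X}, forall i (u : U i), h (dsum_in i u) = f i u.
Proof.
pose F := fun iu : {i : I & U i} => f (tag iu) (tagged iu).
have [|h hE] := @presented_lift _ _ (@dsum_rel k I U) _ F.
  have [L LE] := ex_linear (@freeg_lift_linear k _ _ F).
  move=> D [i u u'|a i u]; rewrite -LE !linearB ?linearZ /= !LE !liftU !scale1r;
    rewrite /F /=.
    by rewrite linearD -addrA -opprD subrr.
  by rewrite linearZ scalerN subrr.
by exists h => i u; rewrite hE.
Qed.

Lemma dsum_ext (f g : {linear dsum U -> X}) :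
  (forall i (u : U i), f (dsum_in i u) = g (dsum_in i u)) -> f =1 g.
Proof. by move=> fg; apply: presented_ext => -[i u]; exact: fg. Qed.

End DirectSum.
End Bilinear.

(** * Universal property of one degree of a graded tensor product *)

Section GradedTensor.
Context {k : fieldType} {K : zmodType}.
Implicit Types U V W X Y Z T : Vect k K.

Lemma gtens_bilinear V W (e n m : K) (nme : n + m == e) :
  is_bilinear (@gtens k K V W e n m nme).
Proof.
have [tDl tDr tZl tZr] := @tens_bilinear k (V n) (W m).
have [p pE] := ex_linear (@dsum_in_linear _ _
  (fun nm : {nm : K * K | nm.1 + nm.2 == e} => tensor (V (val nm).1) (W (val nm).2))
  (exist _ (n, m) nme)).
by rewrite /gtens; split=> *; rewrite -!pE ?tDl ?tDr ?tZl ?tZr ?linearD ?linearZ.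
Qed.

(** The family [f] receives the proof of [n + m == e], so that its values may be pure tensors whose
    own degree proofs are derived from it. Proof irrelevance for booleans makes the value
    independent of that proof. *)
Lemma gtensor_lift V W (X : lmodType k) (e : K)
    (f : forall n m, n + m == e -> V n -> W m -> X) :
  (forall n m nme, is_bilinear (@f n m nme)) ->
  exists h : {linear gtensor k K V W e -> X},
    forall n m (nme : n + m == e) v w, h (gtens nme v w) = f n m nme v w.
Proof.
move=> fbil.
pose S := {nm : K * K | nm.1 + nm.2 == e}.
pose g (nm : S) := cid (tensor_lift (fbil _ _ (valP nm))).
have [h hE] := dsum_lift (fun nm => sval (g nm)).
exists h => n m nme v w; rewrite hE (svalP (g _)).
by congr f; exact: bool_irrelevance.
Qed.

Lemma gtensor_ext V W (X : lmodType k) (e : K)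
    (f g : {linear gtensor k K V W e -> X}) :
  (forall n m (nme : n + m == e) v w, f (gtens nme v w) = g (gtens nme v w)) ->
  f =1 g.
Proof.
move=> fg; apply: dsum_ext => -[[n m] nme].
pose i : {nm : K * K | nm.1 + nm.2 == e} := exist _ (n, m) nme.
have [p pE] := ex_linear (@dsum_in_linear _ _
  (fun nm : {nm : K * K | nm.1 + nm.2 == e} =>
    tensor (V (val nm).1) (W (val nm).2)) i).
(* Both sides are displayed as linear maps on a single summand, an ordinary tensor product. *)
move=> u; rewrite -!pE -!/((_ \o p) _).
by apply: tensor_ext => v w /=; rewrite pE; exact: fg.
Qed.

End GradedTensor.

(** * Pure tensors in iterated graded tensor products *)

Section GradedMonoidal.
Context {k : fieldType} {K : zmodType}.
Implicit Types U V W X Y Z T : Vect k K.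
Local Notation "V ⊗ W" := (gtensor k K V W) (at level 40, left associativity).
Local Notation "𝟙" := (gunit k K).

(** Degree proof for a rebracketed pure tensor: the new inner degree is taken to be [m + p] itself,
    so that [eqxx] serves as the inner proof. *)
Lemma addr_assocl (e a n m p : K) : n + m == a -> a + p == e -> n + (m + p) == e.
Proof. by rewrite addrA => /eqP ->. Qed.

Lemma addr_assocr (e b n m p : K) : m + p == b -> n + b == e -> (n + m) + p == e.
Proof. by rewrite -addrA => /eqP ->. Qed.

Lemma addr_swap (e n m : K) : n + m == e -> m + n == e.
Proof. by rewrite addrC. Qed.

Lemma gtensDl V W e n m (nme : n + m == e) v v' w :
  gtens nme (v + v') w = gtens nme v w + gtens nme v' w :> (V ⊗ W) e.
Proof. by have [] := gtens_bilinear V W nme. Qed.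

Lemma gtensDr V W e n m (nme : n + m == e) v w w' :
  gtens nme v (w + w') = gtens nme v w + gtens nme v w' :> (V ⊗ W) e.
Proof. by have [] := gtens_bilinear V W nme. Qed.

Lemma gtensZl V W e n m (nme : n + m == e) a v w :
  gtens nme (a *: v) w = a *: gtens nme v w :> (V ⊗ W) e.
Proof. by have [] := gtens_bilinear V W nme. Qed.

Lemma gtensZr V W e n m (nme : n + m == e) a v w :
  gtens nme v (a *: w) = a *: gtens nme v w :> (V ⊗ W) e.
Proof. by have [] := gtens_bilinear V W nme. Qed.

(** Freezing one factor leaves a linear map in the other; when that other factor is itself a tensor
    product, extensionality can then be applied to it. *)
Lemma gtens_comp_l V W e n m (nme : n + m == e) w (X : lmodType k)
    (f : {linear (V ⊗ W) e -> X}) :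
  exists h : {linear V n -> X}, forall v, h v = f (gtens nme v w).
Proof.
apply: ex_linear => a v v'.
by rewrite gtensDl gtensZl linearP.
Qed.

Lemma gtens_comp_r V W e n m (nme : n + m == e) v (X : lmodType k)
    (f : {linear (V ⊗ W) e -> X}) :
  exists h : {linear W m -> X}, forall w, h w = f (gtens nme v w).
Proof.
apply: ex_linear => a w w'.
by rewrite gtensDr gtensZr linearP.
Qed.

Lemma gtensor_ext_l U V W e (X : lmodType k)
    (f g : {linear ((U ⊗ V) ⊗ W) e -> X}) :
  (forall a n m p (nma : n + m == a) (ape : a + p == e) u v w,
     f (gtens ape (gtens nma u v) w) = g (gtens ape (gtens nma u v) w)) ->
  f =1 g.
Proof.
move=> fg; apply: gtensor_ext => a p ape y w.
have [h hE] := gtens_comp_l ape w f; have [h' h'E] := gtens_comp_l ape w g.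
rewrite -hE -h'E; apply: gtensor_ext => n m nma u v.
by rewrite hE h'E fg.
Qed.

Lemma gtensor_ext_r U V W e (X : lmodType k)
    (f g : {linear (U ⊗ (V ⊗ W)) e -> X}) :
  (forall b n m p (mpb : m + p == b) (nbe : n + b == e) u v w,
     f (gtens nbe u (gtens mpb v w)) = g (gtens nbe u (gtens mpb v w))) ->
  f =1 g.
Proof.
move=> fg; apply: gtensor_ext => n b nbe u y.
have [h hE] := gtens_comp_r nbe u f; have [h' h'E] := gtens_comp_r nbe u g.
rewrite -hE -h'E; apply: gtensor_ext => m p mpb v w.
by rewrite hE h'E fg.
Qed.

Lemma graded_ext V W (f g : mor V W) : (forall n, f n =1 g n) -> f = g.
Proof.
by move=> fg; apply: functional_extensionality_dep => n; exact: linear_ext.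
Qed.

(** * Structure maps obtained degree by degree *)

Lemma graded_choice V W (P : forall n, {linear V n -> W n} -> Prop) :
  (forall n, exists h : {linear V n -> W n}, P n h) ->
  exists f : mor V W, forall n, P n (f n).
Proof. by move=> ex; exists (fun n => sval (cid (ex n))) => n; case: cid. Qed.

Lemma gtenm_sig V V' W W' (f : mor V V') (g : mor W W') :
  {h : mor (V ⊗ W) (V' ⊗ W') | forall e n m (nme : n + m == e) v w,
    h e (gtens nme v w) = gtens nme (f n v) (g m w)}.
Proof.
apply: cid.
apply: (graded_choice (P := fun e h => forall n m (nme : n + m == e) v w,
    h (gtens nme v w) = gtens nme (f n v) (g m w))) => e.
apply: (gtensor_lift (f := fun n m nme v w => gtens nme (f n v) (g m w))).
move=> n m nme; split=> *;
  by rewrite ?linearD ?linearZ ?gtensDl ?gtensDr ?gtensZl ?gtensZr.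
Qed.

(** The formula quantifies over all intermediate degrees [a], [b] and all degree proofs, so later
    computations never transport along an equality of degrees. *)
Lemma gassoc_sig U V W :
  {h : mor ((U ⊗ V) ⊗ W) (U ⊗ (V ⊗ W)) |
  forall e a b n m p (nma : n + m == a) (ape : a + p == e)
    (mpb : m + p == b) (nbe : n + b == e) u v w,
    h e (gtens ape (gtens nma u v) w) = gtens nbe u (gtens mpb v w)}.
Proof.
apply: cid.
apply: (graded_choice (P := fun e h => forall a b n m p (nma : n + m == a)
  (ape : a + p == e) (mpb : m + p == b) (nbe : n + b == e) u v w,
    h (gtens ape (gtens nma u v) w) = gtens nbe u (gtens mpb v w))) => e.
(* The map is built in two stages: for fixed [w] it is defined on the inner product, and the result
   [phi] is then shown bilinear and lifted again. *)
have ex a p (ape : a + p == e) (w : W p) :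
    exists h : {linear (U ⊗ V) a -> (U ⊗ (V ⊗ W)) e},
    forall n m (nma : n + m == a) u v, h (gtens nma u v) =
      gtens (addr_assocl nma ape) u (gtens (eqxx (m + p)) v w).
  apply: (gtensor_lift (f := fun n m nma u v =>
    gtens (addr_assocl nma ape) u (gtens (eqxx (m + p)) v w))).
  by move=> n m nma; split=> *; rewrite ?gtensDl ?gtensZl ?gtensDr ?gtensZr.
pose phi a p ape y w := sval (cid (@ex a p ape w)) y.
have phiE a p ape w n m (nma : n + m == a) u v :
    phi a p ape (gtens nma u v) w =
    gtens (addr_assocl nma ape) u (gtens (eqxx (m + p)) v w).
  by rewrite /phi; case: cid.
have [a p ape|h hE] := @gtensor_lift _ _ (U ⊗ V) W _ e phi.
  split=> [y y' w|y w w'|c y w|c y w]; rewrite /phi ?linearD ?linearZ //.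
    (* Linearity in [w] is not part of the construction of [phi]. Both sides are linear in [y], so
       it can be tested on pure tensors. *)
    rewrite -[RHS]/((_ \+ _) y); apply: gtensor_ext => n m nma u v /=.
    by rewrite -!/(phi _ _ _ _ _) !phiE !(gtensDl, gtensDr).
  rewrite -[RHS]/((_ \*: _) y); apply: gtensor_ext => n m nma u v /=.
  by rewrite -!/(phi _ _ _ _ _) !phiE !(gtensZl, gtensZr).
exists h => a b n m p nma ape mpb nbe u v w.
(* The map was defined with inner degree [m + p]; as [b] equals it, substitution leaves only degree
   proofs to identify. *)
rewrite hE phiE; move: (mpb) nbe; move/eqP: mpb => <- mpb nbe.
rewrite (bool_irrelevance mpb (eqxx _)).
by rewrite (bool_irrelevance nbe (addr_assocl nma ape)).
Qed.

Lemma gassocV_sig U V W :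
  {h : mor (U ⊗ (V ⊗ W)) ((U ⊗ V) ⊗ W) |
  forall e a b n m p (nma : n + m == a) (ape : a + p == e)
    (mpb : m + p == b) (nbe : n + b == e) u v w,
    h e (gtens nbe u (gtens mpb v w)) = gtens ape (gtens nma u v) w}.
Proof.
apply: cid.
apply: (graded_choice (P := fun e h => forall a b n m p (nma : n + m == a)
  (ape : a + p == e) (mpb : m + p == b) (nbe : n + b == e) u v w,
    h (gtens nbe u (gtens mpb v w)) = gtens ape (gtens nma u v) w)) => e.
have ex n b (nbe : n + b == e) (u : U n) :
    exists h : {linear (V ⊗ W) b -> ((U ⊗ V) ⊗ W) e},
    forall m p (mpb : m + p == b) v w, h (gtens mpb v w) =
      gtens (addr_assocr mpb nbe) (gtens (eqxx (n + m)) u v) w.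
  apply: (gtensor_lift (f := fun m p mpb v w =>
    gtens (addr_assocr mpb nbe) (gtens (eqxx (n + m)) u v) w)).
  by move=> m p mpb; split=> *; rewrite ?gtensDr ?gtensZr ?gtensDl ?gtensZl.
pose phi n b nbe u y := sval (cid (@ex n b nbe u)) y.
have phiE n b nbe u m p (mpb : m + p == b) v w :
    phi n b nbe u (gtens mpb v w) =
    gtens (addr_assocr mpb nbe) (gtens (eqxx (n + m)) u v) w.
  by rewrite /phi; case: cid.
have [n b nbe|h hE] := @gtensor_lift _ _ U (V ⊗ W) _ e phi.
  split=> [u u' y|u y y'|c u y|c u y]; rewrite /phi ?linearD ?linearZ //.
    rewrite -[RHS]/((_ \+ _) y); apply: gtensor_ext => m p mpb v w /=.
    by rewrite -!/(phi _ _ _ _ _) !phiE !(gtensDl, gtensDr).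
  rewrite -[RHS]/((_ \*: _) y); apply: gtensor_ext => m p mpb v w /=.
  by rewrite -!/(phi _ _ _ _ _) !phiE !(gtensZl, gtensZr).
exists h => a b n m p nma ape mpb nbe u v w.
rewrite hE phiE; move: (nma) ape; move/eqP: nma => <- nma ape.
rewrite (bool_irrelevance nma (eqxx _)).
by rewrite (bool_irrelevance ape (addr_assocr mpb nbe)).
Qed.

(** A weight depending only on the degrees preserves bilinearity. Stated for any function [c], this
    also yields the inverse of the braiding. *)
Lemma gswap_sig (c : K -> K -> k) V W :
  {h : mor (V ⊗ W) (W ⊗ V) |
  forall e n m (nme : n + m == e) (mne : m + n == e) v w,
    h e (gtens nme v w) = c n m *: gtens mne w v}.
Proof.
apply: cid.
apply: (graded_choice (P := fun e h => forall n m (nme : n + m == e)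
  (mne : m + n == e) v w, h (gtens nme v w) = c n m *: gtens mne w v)) => e.
have [n m nme|h hE] := @gtensor_lift _ _ V W _ e
    (fun n m nme v w => c n m *: (gtens (addr_swap nme) w v : (W ⊗ V) e)).
  move: (addr_swap nme) => mne.
  split=> [v v' w|v w w'|b v w|b v w].
  - by rewrite gtensDr scalerDr.
  - by rewrite gtensDl scalerDr.
  - by rewrite gtensZr !scalerA mulrC.
  - by rewrite gtensZl !scalerA mulrC.
by exists h => n m nme mne v w; rewrite hE (bool_irrelevance mne (addr_swap nme)).
Qed.

(** * The unit object and the unitors *)

Lemma gunit_neq0 (n : K) (c : 𝟙 n) : n != 0 -> c = 0.
Proof.
move=> /negbTE n0; move: c; rewrite /gunit.
(* The length of the row vector is the boolean [n == 0] read as a number; once it is [false] there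
   are no entries. *)
by case: (n == 0) n0 => // _ c; apply/rowP => -[].
Qed.

Lemma gunit_eq0 (c : 𝟙 0) : exists a, c = gscalar K a.
Proof.
move: c; rewrite /gunit /gscalar.
case: (0 == 0) (eqxx (0 : K)) => // _ c; exists (c 0 0).
by apply/rowP => i; rewrite mxE ord1.
Qed.

Lemma gscalarE (a : k) : gscalar K a = a *: gscalar K 1.
Proof. by apply/matrixP => i j; rewrite !mxE mulr1. Qed.

(** The coordinate in degree 0 is taken as the sum of all entries, which makes sense for every
    length and so avoids a cast between types of row vectors. *)
Lemma gunit_functional : exists t : forall n, {linear 𝟙 n -> k^o},
  forall a, t 0 (gscalar K a) = a.
Proof.
have lin n : linear (fun c : 𝟙 n => \sum_j (c : 'rV__) 0 j : k^o).
  move=> a c c'; rewrite scaler_sumr -big_split.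
  by apply: eq_bigr => i _; rewrite !mxE.
exists (fun n => sval (cid (ex_linear (lin n)))) => a; case: cid => g /= ->.
under eq_bigr do rewrite mxE.
by rewrite sumr_const card_ord eqxx.
Qed.

(** Only degree 0 of the unit contributes, and there every element is a multiple of
    [gscalar K 1]. *)
Lemma gunitl_ext V (n : K) (X : lmodType k) (f g : {linear (𝟙 ⊗ V) n -> X}) :
  (forall (n0 : 0 + n == n) v,
     f (gtens n0 (gscalar K 1) v) = g (gtens n0 (gscalar K 1) v)) ->
  f =1 g.
Proof.
move=> fg; apply: gtensor_ext => i m imn c v.
have [h hE] := gtens_comp_l imn v f; have [h' h'E] := gtens_comp_l imn v g.
rewrite -hE -h'E; have [i0|i0] := eqVneq i 0; last first.
  by rewrite (gunit_neq0 c i0) !linear0.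
subst i; have mn : m = n by apply/eqP; rewrite -[m]add0r.
subst m; have [a ->] := gunit_eq0 c.
by rewrite gscalarE !linearZ /= hE h'E fg.
Qed.

Lemma gunitr_ext V (n : K) (X : lmodType k) (f g : {linear (V ⊗ 𝟙) n -> X}) :
  (forall (n0 : n + 0 == n) v,
     f (gtens n0 v (gscalar K 1)) = g (gtens n0 v (gscalar K 1))) ->
  f =1 g.
Proof.
move=> fg; apply: gtensor_ext => m i min v c.
have [h hE] := gtens_comp_r min v f; have [h' h'E] := gtens_comp_r min v g.
rewrite -hE -h'E; have [i0|i0] := eqVneq i 0; last first.
  by rewrite (gunit_neq0 c i0) !linear0.
subst i; have mn : m = n by apply/eqP; rewrite -[m]addr0.
subst m; have [a ->] := gunit_eq0 c.
by rewrite gscalarE !linearZ /= hE h'E fg.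
Qed.

(** The unitors have to be defined on all summands, including those where [m] and [n] differ. The
    zero map is the default there; such summands have a zero unit factor. *)
Lemma degree_cast V (m n : K) :
  exists h : {linear V m -> V n}, forall (e : m = n) v, h v = ecast i (V i) e v.
Proof.
have [mn|mn] := eqVneq m n; last by exists \0 => e; rewrite e eqxx in mn.
(* Equality proofs in [K] are unique, so the cast along any [e : m = m] is the identity. *)
by case: n / mn; exists idfun => e v; rewrite (eq_axiomK e).
Qed.

Lemma glunit_sig V : {h : mor (𝟙 ⊗ V) V |
  forall n (n0 : 0 + n == n) a v, h n (gtens n0 (gscalar K a) v) = a *: v}.
Proof.
apply: cid.
have [t tE] := gunit_functional.
pose cast m n := sval (cid (degree_cast V m n)).
have castE n v : cast n n v = v by rewrite /cast; case: cid => h /= /(_ erefl).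
apply: (graded_choice (P := fun n h => forall (n0 : 0 + n == n) a v,
  h (gtens n0 (gscalar K a) v) = a *: v)) => n.
have [i m imn|h hE] := @gtensor_lift _ _ 𝟙 V _ n
    (fun i m _ c v => t i c *: cast m n v).
  split=> *; rewrite ?linearD ?linearZ ?scalerDl ?scalerDr //=;
    by rewrite ?scalerA ?[t _ _ * _]mulrC.
by exists h => n0 a v; rewrite hE tE castE.
Qed.

Lemma grunit_sig V : {h : mor (V ⊗ 𝟙) V |
  forall n (n0 : n + 0 == n) a v, h n (gtens n0 v (gscalar K a)) = a *: v}.
Proof.
apply: cid.
have [t tE] := gunit_functional.
pose cast m n := sval (cid (degree_cast V m n)).
have castE n v : cast n n v = v by rewrite /cast; case: cid => h /= /(_ erefl).
apply: (graded_choice (P := fun n h => forall (n0 : n + 0 == n) a v,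
  h (gtens n0 v (gscalar K a)) = a *: v)) => n.
have [m i min|h hE] := @gtensor_lift _ _ V 𝟙 _ n
    (fun m i _ v c => t i c *: cast m n v).
  split=> *; rewrite ?linearD ?linearZ ?scalerDl ?scalerDr //=;
    by rewrite ?scalerA ?[t _ _ * _]mulrC.
by exists h => n0 a v; rewrite hE tE castE.
Qed.

Definition gtenm V V' W W' (f : mor V V') (g : mor W W') :
    mor (V ⊗ W) (V' ⊗ W') :=
  sval (gtenm_sig f g).

Definition gassoc U V W : mor ((U ⊗ V) ⊗ W) (U ⊗ (V ⊗ W)) :=
  sval (gassoc_sig U V W).

Definition gassocV U V W : mor (U ⊗ (V ⊗ W)) ((U ⊗ V) ⊗ W) :=
  sval (gassocV_sig U V W).

Definition glunit V : mor (𝟙 ⊗ V) V := sval (glunit_sig V).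

Definition grunit V : mor (V ⊗ 𝟙) V := sval (grunit_sig V).

Definition gswap (c : K -> K -> k) V W : mor (V ⊗ W) (W ⊗ V) :=
  sval (gswap_sig c V W).

Lemma gtenmE V V' W W' (f : mor V V') (g : mor W W') e n m (nme : n + m == e) v w :
  gtenm f g e (gtens nme v w) = gtens nme (f n v) (g m w).
Proof. exact: (svalP (gtenm_sig f g)). Qed.

Lemma gassocE U V W e a b n m p (nma : n + m == a) (ape : a + p == e)
    (mpb : m + p == b) (nbe : n + b == e) (u : U n) (v : V m) (w : W p) :
  gassoc U V W e (gtens ape (gtens nma u v) w) = gtens nbe u (gtens mpb v w).
Proof. exact: (svalP (gassoc_sig U V W)). Qed.

Lemma gassocVE U V W e a b n m p (nma : n + m == a) (ape : a + p == e)
    (mpb : m + p == b) (nbe : n + b == e) (u : U n) (v : V m) (w : W p) :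
  gassocV U V W e (gtens nbe u (gtens mpb v w)) = gtens ape (gtens nma u v) w.
Proof. exact: (svalP (gassocV_sig U V W)). Qed.

Lemma glunitE V n (n0 : 0 + n == n) (a : k) (v : V n) :
  glunit V n (gtens n0 (gscalar K a) v) = a *: v.
Proof. exact: (svalP (glunit_sig V)). Qed.

Lemma grunitE V n (n0 : n + 0 == n) (a : k) (v : V n) :
  grunit V n (gtens n0 v (gscalar K a)) = a *: v.
Proof. exact: (svalP (grunit_sig V)). Qed.

Lemma gswapE c V W e n m (nme : n + m == e) (mne : m + n == e) (v : V n) (w : W m) :
  gswap c V W e (gtens nme v w) = c n m *: gtens mne w v.
Proof. exact: (svalP (gswap_sig c V W)). Qed.

(* Coherence laws, by evaluation on pure tensors *)
Local Opaque gtensor gunit gtens gtenm gassoc gassocV glunit grunit gswap.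

Lemma gtenm_id V W : gtenm (idc V) (idc W) = idc (V ⊗ W).
Proof.
by apply: graded_ext => e; apply: gtensor_ext => n m nme v w; rewrite gtenmE.
Qed.

Lemma gtenm_comp X X' X'' Y Y' Y'' (f : mor X X') (f' : mor X' X'')
    (g : mor Y Y') (g' : mor Y' Y'') :
  gtenm (f' \oc f) (g' \oc g) = gtenm f' g' \oc gtenm f g.
Proof.
by apply: graded_ext => e; apply: gtensor_ext => n m nme v w /=; rewrite !gtenmE.
Qed.

Lemma gassocK X Y Z : gassocV X Y Z \oc gassoc X Y Z = idc _.
Proof.
apply: graded_ext => e; apply: gtensor_ext_l => a n m p nma ape u v w /=.
have mp := eqxx (m + p); have nmp := addr_assocl nma ape.
by rewrite (gassocE nma ape mp nmp u v w) (gassocVE nma ape mp nmp u v w).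
Qed.

Lemma gassocVK X Y Z : gassoc X Y Z \oc gassocV X Y Z = idc _.
Proof.
apply: graded_ext => e; apply: gtensor_ext_r => b n m p mpb nbe u v w /=.
have nm := eqxx (n + m); have nmp := addr_assocr mpb nbe.
by rewrite (gassocVE nm nmp mpb nbe u v w) (gassocE nm nmp mpb nbe u v w).
Qed.

Lemma gassoc_nat X X' Y Y' Z Z' (f : mor X X') (g : mor Y Y') (h : mor Z Z') :
  gassoc X' Y' Z' \oc gtenm (gtenm f g) h = gtenm f (gtenm g h) \oc gassoc X Y Z.
Proof.
apply: graded_ext => e; apply: gtensor_ext_l => a n m p nma ape u v w /=.
have mp := eqxx (m + p); have nmp := addr_assocl nma ape.
rewrite (gtenmE (gtenm f g) h ape (gtens nma u v) w) (gtenmE f g nma u v).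
rewrite (gassocE nma ape mp nmp (f n u) (g m v) (h p w)).
rewrite (gassocE nma ape mp nmp u v w).
by rewrite (gtenmE f (gtenm g h) nmp u (gtens mp v w)) (gtenmE g h mp v w).
Qed.

Lemma glunit_iso X : is_iso (glunit X).
Proof.
have [g gE] : exists g : mor X (𝟙 ⊗ X),
    forall n x (n0 : 0 + n == n), g n x = gtens n0 (gscalar K 1) x.
  apply: (graded_choice (P := fun n h => forall x (n0 : 0 + n == n),
    h x = gtens n0 (gscalar K 1) x)) => n.
  have n0 : 0 + n == n by rewrite add0r.
  (* Freezing the scalar 1 under the identity map gives the inverse, the tensoring of [x] with 1, as
     a linear map. *)
  have [h hE] := gtens_comp_r n0 (gscalar K 1 : 𝟙 0)
    (idfun : {linear (𝟙 ⊗ X) n -> _}).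
  by exists h => x n0'; rewrite hE (bool_irrelevance n0' n0).
exists g; split; apply: graded_ext => n.
  by apply: gunitl_ext => n0 v /=; rewrite glunitE scale1r (gE _ _ n0).
by move=> v /=; rewrite (gE _ _ (introT eqP (add0r n))) glunitE scale1r.
Qed.

Lemma grunit_iso X : is_iso (grunit X).
Proof.
have [g gE] : exists g : mor X (X ⊗ 𝟙),
    forall n x (n0 : n + 0 == n), g n x = gtens n0 x (gscalar K 1).
  apply: (graded_choice (P := fun n h => forall x (n0 : n + 0 == n),
    h x = gtens n0 x (gscalar K 1))) => n.
  have n0 : n + 0 == n by rewrite addr0.
  have [h hE] := gtens_comp_l n0 (gscalar K 1 : 𝟙 0)
    (idfun : {linear (X ⊗ 𝟙) n -> _}).
  by exists h => x n0'; rewrite hE (bool_irrelevance n0' n0).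
exists g; split; apply: graded_ext => n.
  by apply: gunitr_ext => n0 v /=; rewrite grunitE scale1r (gE _ _ n0).
by move=> v /=; rewrite (gE _ _ (introT eqP (addr0 n))) grunitE scale1r.
Qed.

Lemma glunit_nat X X' (f : mor X X') :
  glunit X' \oc gtenm (idc 𝟙) f = f \oc glunit X.
Proof.
apply: graded_ext => n; apply: gunitl_ext => n0 v /=.
by rewrite gtenmE !glunitE !scale1r.
Qed.

Lemma grunit_nat X X' (f : mor X X') :
  grunit X' \oc gtenm f (idc 𝟙) = f \oc grunit X.
Proof.
apply: graded_ext => n; apply: gunitr_ext => n0 v /=.
by rewrite gtenmE !grunitE !scale1r.
Qed.

Lemma gpentagon X Y Z T :
  gassoc X Y (Z ⊗ T) \oc gassoc (X ⊗ Y) Z T =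
  gtenm (idc X) (gassoc Y Z T) \oc gassoc X (Y ⊗ Z) T
    \oc gtenm (gassoc X Y Z) (idc T).
Proof.
apply: graded_ext => e; apply: gtensor_ext => s q sqe y t.
(* With the outermost factor [t] frozen, both sides are maps out of a triple product. *)
have [h hE] := gtens_comp_l sqe t
  ((gassoc X Y (Z ⊗ T) \oc gassoc (X ⊗ Y) Z T) e).
have [h' h'E] := gtens_comp_l sqe t ((gtenm (idc X) (gassoc Y Z T)
  \oc gassoc X (Y ⊗ Z) T \oc gtenm (gassoc X Y Z) (idc T)) e).
rewrite -hE -h'E; apply: gtensor_ext_l => a n m p nma aps u v w.
rewrite hE h'E /= gtenmE.
have mp := eqxx (m + p); have mps := addr_assocl nma aps.
have pq := eqxx (p + q); have apq := addr_assocl aps sqe.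
have mpq := eqxx (m + (p + q)); have nmpq := addr_assocl nma apq.
have mpq' := addr_assocr pq mpq.
(* [E1] and [E2] evaluate the path with two associators, [E3] to [E5] the path with three; both end
   in the same fully right-bracketed tensor with the same degree proofs. *)
have E1 := gassocE aps sqe pq apq (gtens nma u v) w t.
have E2 := gassocE nma apq mpq nmpq u v (gtens pq w t).
have E3 := gassocE nma aps mp mps u v w.
have E4 := gassocE mps sqe mpq' nmpq u (gtens mp v w) t.
have E5 := gassocE mp mpq' pq mpq v w t.
rewrite [LHS](etrans (congr1 (gassoc X Y (Z ⊗ T) e) E1) E2).
apply/esym; apply: etrans (congr1 (fun x => gtenm (idc X) (gassoc Y Z T) e
  (gassoc X (Y ⊗ Z) T e (gtens sqe x t))) E3) _.
apply: etrans (congr1 (gtenm (idc X) (gassoc Y Z T) e) E4) _.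
apply: etrans (gtenmE _ _ _ _ _) _.
exact: (congr1 (gtens nmpq u) E5).
Qed.


Lemma gtriangle X Y :
  gtenm (idc X) (glunit Y) \oc gassoc X 𝟙 Y = gtenm (grunit X) (idc Y).
Proof.
apply: graded_ext => e; apply: gtensor_ext => n m nme x y.
have [h hE] := gtens_comp_l nme y
  ((gtenm (idc X) (glunit Y) \oc gassoc X 𝟙 Y) e).
have [h' h'E] := gtens_comp_l nme y (gtenm (grunit X) (idc Y) e).
(* With [y] frozen the source is the product of [X] with the unit, so the middle scalar may be taken
   to be 1. *)
rewrite -hE -h'E; apply: gunitr_ext => n0 v.
have m0 : 0 + m == m by rewrite add0r.
rewrite hE h'E /= gtenmE (gassocE n0 nme m0 nme v (gscalar K 1 : 𝟙 0) y) gtenmE.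
by rewrite glunitE grunitE !scale1r.
Qed.

Definition graded_monoidal : monoidal (gtensor k K) 𝟙 :=
  Monoidal gtenm_id gtenm_comp gassocK gassocVK gassoc_nat glunit_iso glunit_nat
    grunit_iso grunit_nat gpentagon gtriangle.

(** * The braiding attached to a bicharacter *)

Section Braiding.
Variable c : K -> K -> k.
Hypothesis c_neq0 : forall n m, c n m != 0.
Hypothesis cDl : forall n n' m, c (n + n') m = c n m * c n' m.
Hypothesis cDr : forall n m m', c n (m + m') = c n m * c n m'.

Lemma gswap_iso X Y : is_iso (gswap c X Y).
Proof.
(* The arguments of [c] are exchanged because the inverse meets the factors in the opposite order;
   the two weights then cancel. *)
exists (gswap (fun n m => (c m n)^-1) Y X).
split; apply: graded_ext => e; apply: gtensor_ext => n m nme x y /=;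
  have mne := addr_swap nme;
  rewrite (gswapE _ nme mne) linearZ /= (gswapE _ mne nme) scalerA.
  by rewrite divff ?c_neq0 // scale1r.
by rewrite mulVf ?c_neq0 // scale1r.
Qed.

Lemma gswap_nat X X' Y Y' (f : mor X X') (g : mor Y Y') :
  gswap c X' Y' \oc gtenm f g = gtenm g f \oc gswap c X Y.
Proof.
apply: graded_ext => e; apply: gtensor_ext => n m nme x y /=.
have mne := addr_swap nme.
by rewrite gtenmE (gswapE _ nme mne x y) linearZ /= gtenmE (gswapE _ nme mne).
Qed.

(** One side moves [x] past the product of [y] and [z], of degree [m + p], at once; the other moves
    it past [y] and then past [z]. Equality of the weights is [cDr]. *)
Lemma ghexagon1 X Y Z :
  gassoc Y Z X \oc gswap c X (Y ⊗ Z) \oc gassoc X Y Z =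
  gtenm (idc Y) (gswap c X Z) \oc gassoc Y X Z \oc gtenm (gswap c X Y) (idc Z).
Proof.
apply: graded_ext => e; apply: gtensor_ext_l => a n m p nma ape x y z /=.
have mp := eqxx (m + p); have nmp := addr_assocl nma ape.
have mpn := addr_swap nmp; have mna := addr_swap nma.
have pn := eqxx (p + n); have np := addr_swap pn.
have mpn' := addr_assocl mp mpn.
apply: etrans (congr1 (fun t => gassoc Y Z X e (gswap c X (Y ⊗ Z) e t))
  (gassocE nma ape mp nmp x y z)) _.
apply: etrans (congr1 (gassoc Y Z X e) (gswapE c nmp mpn x (gtens mp y z))) _.
rewrite linearZ /= (gassocE mp mpn pn mpn' y z x); apply/esym.
apply: etrans (congr1 (fun t => gtenm (idc Y) (gswap c X Z) e (gassoc Y X Z e t))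
  (gtenmE (gswap c X Y) (idc Z) ape (gtens nma x y) z)) _.
rewrite (gswapE c nma mna x y) gtensZl !linearZ /=.
apply: etrans (congr1 (fun t => c n m *: gtenm (idc Y) (gswap c X Z) e t)
  (gassocE mna ape np mpn' y x z)) _.
by rewrite gtenmE (gswapE c np pn x z) gtensZr scalerA cDr.
Qed.

Lemma ghexagon2 X Y Z :
  gassocV Z X Y \oc gswap c (X ⊗ Y) Z \oc gassocV X Y Z =
  gtenm (gswap c X Z) (idc Y) \oc gassocV X Z Y \oc gtenm (idc X) (gswap c Y Z).
Proof.
apply: graded_ext => e; apply: gtensor_ext_r => b n m p mpb nbe x y z /=.
have nm := eqxx (n + m); have nmp := addr_assocr mpb nbe.
have pnm := addr_swap nmp; have pmb := addr_swap mpb.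
have pn := eqxx (p + n); have np := addr_swap pn.
have pnm' := addr_assocr nm pnm.
apply: etrans (congr1 (fun t => gassocV Z X Y e (gswap c (X ⊗ Y) Z e t))
  (gassocVE nm nmp mpb nbe x y z)) _.
apply: etrans (congr1 (gassocV Z X Y e) (gswapE c nmp pnm (gtens nm x y) z)) _.
rewrite linearZ /= (gassocVE pn pnm' nm pnm z x y); apply/esym.
apply: etrans (congr1 (fun t => gtenm (gswap c X Z) (idc Y) e (gassocV X Z Y e t))
  (gtenmE (idc X) (gswap c Y Z) nbe x (gtens mpb y z))) _.
rewrite (gswapE c mpb pmb y z) gtensZr !linearZ /=.
apply: etrans (congr1 (fun t => c m p *: gtenm (gswap c X Z) (idc Y) e t)
  (gassocVE np pnm' pmb nbe x z y)) _.
(* Here [z] passes [y] before [x], so the weights appear in the order opposite to that of [cDl]. *)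
by rewrite gtenmE (gswapE c np pn x z) gtensZl scalerA cDl mulrC.
Qed.

Definition graded_braiding : braiding graded_monoidal :=
  @Braiding _ _ _ graded_monoidal (gswap c) gswap_iso gswap_nat ghexagon1 ghexagon2.

End Braiding.

End GradedMonoidal.

(** * The bicharacter given by the Euler form *)

Theorem theorem3 (k : fieldType) (A : abelian_category k) (d : nat)
    (homdim : has_homological_dim A d) (extfin : ext_finite A)
    (form : K0 A -> K0 A -> int) (formP : is_euler_form d form)
    (q : k) (q0 : q != 0) :
  exists M : monoidal (gtensor k (K0 A)) (gunit k (K0 A)),
  [/\ forall (V V' W W' : Vect k (K0 A)) (f : mor V V') (g : mor W W')
             (e n m : K0 A) (nme : n + m == e) (v : V n) (w : W m),
        tenm M f g e (gtens nme v w) = gtens nme (f n v) (g m w),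
      forall (U V W : Vect k (K0 A)) (e a b n m p : K0 A)
             (nma : n + m == a) (ape : a + p == e)
             (mpb : m + p == b) (nbe : n + b == e)
             (u : U n) (v : V m) (w : W p),
        assoc M U V W e (gtens ape (gtens nma u v) w)
        = gtens nbe u (gtens mpb v w),
      forall (V : Vect k (K0 A)) (n : K0 A) (n0 : 0 + n == n) (a : k) (v : V n),
        lunit M V n (gtens n0 (gscalar (K0 A) a) v) = a *: v,
      forall (V : Vect k (K0 A)) (n : K0 A) (n0 : n + 0 == n) (a : k) (v : V n),
        runit M V n (gtens n0 v (gscalar (K0 A) a)) = a *: v
    & exists B : braiding M,
      forall (V W : Vect k (K0 A)) (e n m : K0 A)
             (nme : n + m == e) (mne : m + n == e) (v : V n) (w : W m),
        braid B V W e (gtens nme v w) = q ^ (- form n m) *: gtens mne w v].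
Proof.
have [formDl formDr _] := formP.
(* As [q] is non-zero, its integer powers are non-zero and turn sums of exponents into products, so
   biadditivity of [form] gives the three bicharacter conditions. *)
have c_neq0 n m : q ^ (- form n m) != 0 by rewrite expfz_neq0.
have cDl n n' m : q ^ (- form (n + n') m) = q ^ (- form n m) * q ^ (- form n' m).
  by rewrite formDl opprD expfzDr.
have cDr n m m' : q ^ (- form n (m + m')) = q ^ (- form n m) * q ^ (- form n m').
  by rewrite formDr opprD expfzDr.
exists graded_monoidal; split;
  [exact: gtenmE|exact: gassocE|exact: glunitE|exact: grunitE|].
by exists (graded_braiding c_neq0 cDl cDr) => *; exact: gswapE.
Qed.
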